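(* (1) If $X$ is a Tychonoff space such that the free Boolean topological group $B_G(X)$ is an $F'$-space, then $X$ contains at most one point which is not a $P$-point. (2) If $X$ is a Tychonoff space which is not a $P$-space and $B_G(X)$ is an $F'$-space, then there exists a countable Tychonoff space $Z$ with exactly one nonisolated point such that $Z$ is the image of $X$ under an $\mathbb R$-quotient map and $B_G(Z)$ is an extremally disconnected topological quotient group of $B_G(X)$.
   Context: All spaces are Tychonoff. A space is an $F'$-space if any two disjoint cozero sets in it have disjoint closures; it is extremally disconnected if the closure of every open set is open. A point is a $P$-point if every $G_\delta$-set containing it is a neighborhood of it; a $P$-space is a space all of whose points are $P$-points. For a space $X$ with a fixed point $x_0$, the Graev free Boolean topological group $B_G(X)$ is the unique Boolean topological group (all elements of order at most $2$) with identity $x_0$ containing $X$ as a subspace such that every continuous map from $X$ to a Boolean topological group sending $x_0$ to the identity extends to a continuous homomorphism; algebraically it is the group of finite subsets of $X\setminus\{x_0\}$ under symmetric difference, and it does not depend on $x_0$ up to topological isomorphism. A continuous surjection $p\colon X\to Y$ is $\mathbb R$-quotient if a function $\varphi\colon Y\to\mathbb R$ is continuous exactly when $\varphi\circ p$ is continuous. A topological quotient group of $G$ is $G/N$ with the quotient topology, $N$ a closed normal subgroup. *)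

(* Defs.v *)
From HB Require Import structures.
From mathcomp Require Import all_boot all_order all_algebra.
From mathcomp Require Import all_classical all_reals all_analysis.
From mathcomp Require Import Rstruct Rstruct_topology.
Set Implicit Arguments. Unset Strict Implicit. Unset Printing Implicit Defensive.
Import Order.TTheory GRing.Theory Num.Theory.
Local Open Scope classical_set_scope.
Local Open Scope ring_scope.

Notation Real := Rdefinitions.R.

Definition tychonoff_space (X : topologicalType) : Prop :=
  accessible_space X /\
  forall (B : set X) (a : X), closed B -> ~ B a ->
    exists f : X -> Real, continuous f /\ f a = 0 /\ (forall b, B b -> f b = 1).

Definition cozero (X : topologicalType) (f : X -> Real) : set X :=
  [set x | f x != 0].

Definition F'_space (X : topologicalType) : Prop :=
  forall f g : X -> Real, continuous f -> continuous g ->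
    cozero f `&` cozero g = set0 ->
    closure (cozero f) `&` closure (cozero g) = set0.

Definition extremally_disconnected (X : topologicalType) : Prop :=
  forall U : set X, open U -> open (closure U).

Definition P_point (X : topologicalType) (x : X) : Prop :=
  forall U : nat -> set X, (forall n, open (U n)) -> (forall n, U n x) ->
    nbhs x (\bigcap_n U n).

Definition P_space (X : topologicalType) : Prop := forall x : X, P_point x.

Definition isolated_point (X : topologicalType) (x : X) : Prop := open [set x].

Definition R_quotient (X Y : topologicalType) (p : X -> Y) : Prop :=
  continuous p /\ (forall y, exists x, p x = y) /\
  forall phi : Y -> Real, continuous phi <-> continuous (phi \o p).

Definition embedding (X Y : topologicalType) (e : X -> Y) : Prop :=
  injective e /\ continuous e /\
  forall U : set X, open U -> exists V : set Y, open V /\ e @^-1` V = U.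

Definition boolean_group (G : zmodType) : Prop := forall x : G, x + x = 0.

(* (B, e) is the Graev free Boolean topological group over (X, x0):
   B is a Boolean topological group with identity e x0, X embeds in B via e,
   e(X) generates B algebraically, and every continuous map from X to a
   Boolean topological group sending x0 to the identity extends to a
   continuous homomorphism. *)
Definition free_boolean_group (X : topologicalType) (x0 : X)
    (B : topologicalZmodType) (e : X -> B) : Prop :=
  [/\ boolean_group B, e x0 = 0, embedding e,
      (forall b : B, exists s : seq X, b = \sum_(x <- s) e x) &
      forall (H : topologicalZmodType) (f : X -> H),
        boolean_group H -> continuous f -> f x0 = 0 ->
        exists phi : B -> H,
          [/\ continuous phi, {morph phi : u v / u + v} &
              forall x, phi (e x) = f x]].

(* q : B -> Q exhibits Q as a topological quotient group of B:
   q is a surjective homomorphism and Q carries the quotient topology,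
   so that Q is B / ker q with the quotient topology. *)
Definition topological_quotient_group (B Q : topologicalZmodType) (q : B -> Q) : Prop :=
  [/\ {morph q : u v / u + v}, (forall y, exists x, q x = y) &
      forall U : set Q, open U <-> open (q @^-1` U)].

(* Main.v *)
(** Any seminorm on a Boolean group [V] defines a (possibly non-Hausdorff)
group topology, so the universal property of [B] extends every
seminorm-continuous map [X -> V] to a homomorphism [phi] for which the seminorm
of [phi b] is a continuous real function of [b].

(1) A real function [f] on [X] gives the map [u |-> [0, f u)] into the Boolean
group of subsets of the line under symmetric difference, with Lebesgue outer
measure as seminorm. If [x <> y] are not P-points, choose nonnegative [f], [g]
with [f g = 0], vanishing at [x] and [y], such that [f] is not locally zero at
[x] nor [g] at [y]; they yield continuous [M], [N] on [B]. At [u + y] with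
[u] near [x] and [f u > 0] one has [M > 0 = N], and symmetrically at [x + w], so
[x + y] is in the closures of the disjoint cozero sets [M > N] and [N > M].

(2) Let [x] be the only non-P-point and [f >= 0] continuous, [f x = 0], [f] not
locally zero at [x]. As the other points are P-points, [f] is locally constant
off [x], so cutting its range along a sequence decreasing to 0 gives a quotient
map [p] from [X] onto a countable space [Z] whose only nonisolated point is the
image of [x]. Then [B_G(Z)] is the algebraic free Boolean group with the
quotient topology of [B]. The quotient map is open, so the F'-property descends;
and in a countable topological group every open set is cozero, so the
F'-property is extremal disconnectedness. *)

Require Import Defs.
From HB Require Import structures.
From mathcomp Require Import all_boot all_order all_algebra.
From mathcomp Require Import all_classical all_reals all_analysis.
From mathcomp Require Import Rstruct Rstruct_topology.
From mathcomp Require Import lra.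
Set Implicit Arguments. Unset Strict Implicit. Unset Printing Implicit Defensive.
Import Order.TTheory GRing.Theory Num.Theory.
Import numFieldNormedType.Exports.
Local Open Scope classical_set_scope.
Local Open Scope ring_scope.

Local Notation R := Rdefinitions.R.

(** * Zero sets and functions at points that are not P-points *)

(** [g] is the supremum of the [|f n|] capped at [1/(n+1)]. The caps tend to 0, so up to any [e]
    only finitely many terms matter, and [g] is continuous. *)
Lemma zero_set_bigcap (K : realType) (T : topologicalType) (f : nat -> T -> K) :
  (forall n, continuous (f n)) ->
  exists g : T -> K, [/\ continuous g, forall x, 0 <= g x &
    forall x, g x = 0 <-> forall n, f n x = 0].
Proof.
move=> fc.
pose h n x : K := Num.min `|f n x| n.+1%:R^-1.
pose g x := sup (range (h^~ x)).
have h0 n x : 0 <= h n x by rewrite le_min normr_ge0 invr_ge0 ler0n.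
have hn n x : h n x <= n.+1%:R^-1 by rewrite ge_min lexx orbT.
have hs x : has_sup (range (h^~ x)).
  split; first by exists (h 0%N x), 0%N.
  exists 1 => _ [n _ <-]; apply: le_trans (hn n x) _.
  by rewrite invf_le1 ?ltr0n// ler1n.
have hg n x : h n x <= g x by apply: ub_le_sup; [case: (hs x) | exists n].
have gh x e : (forall n, h n x <= e) -> g x <= e.
  by move=> he; apply: ge_sup; [case: (hs x) | move=> _ [n _ <-]].
have hc n : continuous (h n).
  move=> x; apply: (@continuous_min K T); last exact: cvg_cst.
  by apply: continuous_comp; [exact: fc | exact: norm_continuous].
exists g; split.
- move=> x; apply/cvgrPdist_le => e e0.
  have [N Ne] : exists N, N.+1%:R^-1 < e.
    by have [N _ /(_ N (leqnn N))] := near_infty_natSinv_lt (PosNum e0); exists N.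
  have : \forall y \near x, forall n, (n < N)%N -> `|h n x - h n y| <= e.
    elim: N {Ne} => [|N IH]; first by apply: nearW.
    have := hc N x; move/cvgrPdist_le => /(_ _ e0) hN.
    apply: filterS2 IH hN => y IH hN n.
    by rewrite ltnS leq_eqVlt => /predU1P[->//|/IH].
  apply: filterS => y H.
  have {}H n : `|h n x - h n y| <= e.
    have [/H//|nN] := ltnP n N.
    have A : n.+1%:R^-1 < e.
      by apply: le_lt_trans Ne; rewrite lef_pV2 ?posrE ?ltr0n// ler_nat.
    have := h0 n x; have := h0 n y.
    have := le_lt_trans (hn n x) A; have := le_lt_trans (hn n y) A.
    by rewrite ler_norml; move: (h n x) (h n y) => a b *; apply/andP; split; lra.
  rewrite ler_norml; apply/andP; split.
    rewrite -lerN2 opprK opprB lerBlDr; apply: gh => n.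
    by have := hg n x; have := H n; rewrite ler_norml => /andP[]; lra.
  rewrite lerBlDr; apply: gh => n.
  by have := hg n y; have := H n; rewrite ler_norml => /andP[]; lra.
- by move=> x; apply: le_trans (hg 0%N x).
- move=> x; split=> [gx n|fx].
    have : h n x == 0 by rewrite eq_le h0 andbT -gx hg.
    rewrite /h; case: ltP => _; first by rewrite normr_eq0 => /eqP.
    by rewrite invr_eq0 pnatr_eq0.
  apply/eqP; rewrite eq_le; apply/andP; split.
    by apply: gh => n; rewrite /h fx normr0 ge_min lexx.
  exact: le_trans (hg 0%N x).
Qed.

(** A [G_delta] set witnessing the failure at [x] contains a zero set through [x]: separate [x] from
    the complement of each [U n] and combine the functions. *)
Lemma non_P_point_function (X : topologicalType) (x : X) :
  tychonoff_space X -> ~ P_point x ->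
  exists f : X -> R, [/\ continuous f, forall u, 0 <= f u, f x = 0 &
    ~ nbhs x [set u | f u = 0]].
Proof.
move=> [_ tX] /existsNP[U] /not_implyP[Uo] /not_implyP[Ux nU].
have /choice[f fP] n : exists f : X -> R, continuous f /\ f x = 0 /\
    forall b, (~` U n) b -> f b = 1.
  by apply: tX; [exact: open_closedC | apply].
have [g [gc g0 gE]] := @zero_set_bigcap _ X f (fun n => (fP n).1).
exists g; split=> //; first by apply/gE => n; have [_ []] := fP n.
move=> ng; apply: nU; apply: filterS ng => u /= /gE fu n _.
apply: contrapT => /(fP n).2.2; rewrite fu => /eqP.
by rewrite eq_sym oner_eq0.
Qed.

(** * Group topologies given by seminorms *)

Section SeminormGroup.
Variables (K : realType) (V : zmodType) (N : V -> K).

(** The one inequality for differences yields both symmetry and subadditivity. *)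
Definition group_seminorm := N 0 = 0 /\ forall x y, N (x - y) <= N x + N y.

Hypothesis hN : group_seminorm.

Lemma group_seminormN x : N (- x) = N x.
Proof.
have [N0 H] := hN; apply/eqP; rewrite eq_le.
have := H 0 x; have := H 0 (- x); rewrite N0 !sub0r opprK !add0r.
by move=> -> ->.
Qed.

Lemma group_seminormD x y : N (x + y) <= N x + N y.
Proof. by have [_ /(_ x (- y))] := hN; rewrite opprK group_seminormN. Qed.

Lemma group_seminorm_dist x y : `|N x - N y| <= N (x - y).
Proof.
rewrite ler_norml; apply/andP; split.
  have := group_seminormD (- (x - y)) x; rewrite group_seminormN.
  by rewrite opprB subrK; lra.
by have := group_seminormD (x - y) y; rewrite subrK; lra.
Qed.

End SeminormGroup.

(** A copy of [V] indexed by [hN], so that each seminorm brings its own topology. *)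
Definition seminorm_group (K : realType) (V : zmodType) (N : V -> K)
  (hN : group_seminorm N) : Type := V.

Section SeminormGroupTopology.
Variables (K : realType) (V : zmodType) (N : V -> K) (hN : group_seminorm N).
Local Notation G := (seminorm_group hN).

Definition seminorm_nbhs (x : G) : set_system G :=
  filter_from [set e : K | 0 < e] (fun e => [set y : V | N (y - x) < e]).

HB.instance Definition _ := GRing.Zmodule.on G.
HB.instance Definition _ := hasNbhs.Build G seminorm_nbhs.

Let nbhs_filter (x : G) : ProperFilter (nbhs x).
Proof.
apply: filter_from_proper; last first.
  by move=> e e0; exists x; rewrite /= subrr hN.1.
apply: filter_from_filter; first by exists 1 => /=.
move=> e1 e2 /= e10 e20; exists (Num.min e1 e2); first by rewrite lt_min e10.
by move=> y /=; rewrite lt_min => /andP[].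
Qed.

Let nbhs_singleton (x : G) (A : set G) : nbhs x A -> A x.
Proof. by move=> [e /= e0]; apply; rewrite /= subrr hN.1. Qed.

Let nbhs_nbhs (x : G) (A : set G) : nbhs x A -> nbhs x (nbhs^~ A).
Proof.
move=> [e /= e0 eA]; exists (e / 2); first by rewrite /= divr_gt0.
move=> y /= yx; exists (e / 2); first by rewrite /= divr_gt0.
move=> z /= zy; apply: eA => /=.
have := group_seminormD hN (z - y) (y - x).
rewrite addrA subrK; move: zy yx; lra.
Qed.

HB.instance Definition _ :=
  Nbhs_isNbhsTopological.Build G nbhs_filter nbhs_singleton nbhs_nbhs.

Let sub_continuous : continuous (fun x : G * G => x.1 - x.2).
Proof.
move=> [a b] A /= [e /= e0 eA].
exists ([set x : G | N (x - a) < e / 2], [set x : G | N (x - b) < e / 2]).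
  by split; exists (e / 2) => //=; rewrite divr_gt0.
move=> [x y] /= [xa yb]; apply: eA => /=.
have := hN.2 (x - a) (y - b).
have -> : x - a - (y - b) = x - y - (a - b) :> V by rewrite !opprD !opprK addrACA.
by move: xa yb; lra.
Qed.

HB.instance Definition _ :=
  PreTopologicalNmodule_isTopologicalZmodule.Build G sub_continuous.

Lemma seminorm_continuous : continuous (N : G -> K).
Proof.
move=> x; apply/(@cvgrPdist_lt K K^o G (nbhs x) (nbhs_filter x)) => e e0.
exists e => // y /= yx.
by rewrite distrC; apply: le_lt_trans yx; exact: group_seminorm_dist.
Qed.

End SeminormGroupTopology.

Lemma morph_add0 (U V : zmodType) (phi : U -> V) :
  {morph phi : u v / u + v} -> phi 0 = 0.
Proof. by move=> phiD; apply: (addrI (phi 0)); rewrite -phiD !addr0. Qed.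

Lemma eq_on_generators (I : Type) (B V : zmodType) (e : I -> B)
    (phi psi : B -> V) :
  (forall b, exists s : seq I, b = \sum_(x <- s) e x) ->
  {morph phi : u v / u + v} -> {morph psi : u v / u + v} ->
  (forall x, phi (e x) = psi (e x)) -> phi =1 psi.
Proof.
move=> gen phiD psiD eq b; have [s ->] := gen b.
elim: s => [|x s IH]; first by rewrite big_nil !morph_add0.
by rewrite big_cons phiD psiD eq IH.
Qed.

(** Only continuity of [N \o phi] is kept, so that later arguments deal with real functions on [B]
    and not with the topology of [V]. *)
Lemma free_seminorm_extension (K : realType) (X : topologicalType) (x0 : X)
    (B : topologicalZmodType) (e : X -> B)
    (V : zmodType) (N : V -> K) (f : X -> V) :
  free_boolean_group x0 e -> group_seminorm N -> boolean_group V -> f x0 = 0 ->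
  (forall u eps, 0 < eps -> \forall v \near u, N (f v - f u) < eps) ->
  exists phi : B -> V, [/\ {morph phi : u v / u + v},
    forall x, phi (e x) = f x & continuous (N \o phi)].
Proof.
move=> [_ _ _ _ univ] hN V2 fx0 fc.
have [|phi [phic phiD phie]] := univ (seminorm_group hN) f V2 _ fx0.
  move=> u A [eps /= eps0 epsA]; have := fc u eps eps0.
  by apply: filterS => v; exact: epsA.
exists phi; split=> // b.
by apply: continuous_comp; [exact: phic | exact: seminorm_continuous].
Qed.

(** * Intervals in the Boolean group of subsets of the line *)

Section IntervalGroup.
Variable K : realType.
Local Notation V := (K -> 'F_2).
Local Notation mu := (@lebesgue_measure K).

(* Capped at 1 so that it is finite on all sets of reals. *)
Definition support_size (v : V) : K :=
  fine (Order.min (mu [set t | v t != 0]) 1%E).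

Definition initial_interval (s : K) : V := fun t => (0 <= t < s)%R%:R.

Let mu0 (A : set K) : (0 <= mu A)%E.
Proof. exact: outer_measure_ge0. Qed.

Let le_mu (A B : set K) : A `<=` B -> (mu A <= mu B)%E.
Proof. exact: (@le_mu_ext _ _ _ (wlength idfun)). Qed.

Let muU (A B : set K) : (mu (A `|` B) <= mu A + mu B)%E.
Proof.
(* The sets are arbitrary, so subadditivity is taken from the outer measure behind [mu], which asks
   for no measurability. *)
pose m : {outer_measure set (ocitv_type K) -> \bar K} := (wlength idfun)^*%mu.
exact (outer_measureU2 m A B).
Qed.

Lemma boolean_group_F2fun : boolean_group V.
Proof.
move=> v; apply/funext => t; rewrite addrfctE.
by case: (v t) => [[|[|]] //= H]; apply/val_inj.
Qed.

Lemma group_seminorm_support_size : group_seminorm support_size.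
Proof.
split.
  rewrite /support_size (_ : [set t | _] = set0).
    by rewrite measure0 min_l// lee01.
  by apply/seteqP; split => // t /=; rewrite eqxx.
move=> v w; have ssub : [set t | (v - w) t != 0] `<=`
    [set t | v t != 0] `|` [set t | w t != 0].
  move=> t /=; rewrite opprfctE addrfctE; have [->|] := eqVneq (v t) 0; last by left.
  by rewrite sub0r oppr_eq0; right.
have := le_trans (le_mu ssub) (muU _ _).
rewrite /support_size.
move: (mu _) (mu0 [set t | (v - w) t != 0]) => c c0.
move: (mu _) (mu0 [set t | v t != 0]) => a a0.
move: (mu _) (mu0 [set t | w t != 0]) => b b0 cab.
have min1 (x : \bar K) : (0 <= x)%E -> 0 <= fine (Order.min x 1%E) <= 1.
  case: x => [x||]//=; rewrite ?lee_fin => x0; last first.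
    by rewrite lexx ler01.
  by rewrite -EFin_min /= le_min x0 ler01 ge_min lexx orbT.
have := min1 _ a0; have := min1 _ b0; have := min1 _ c0.
(* If [a] or [b] is at least 1, its capped value 1 already bounds the left side; otherwise both are
   finite. *)
have [a1|a1] := leP 1%E a; first by rewrite /=; lra.
have [b1|b1] := leP 1%E b; first by rewrite /=; lra.
move=> _ _ _.
case: a a0 a1 cab => [a||]//= a0 a1; case: b b0 b1 => [b||]//= b0 b1.
case: c c0 => [c||]//= c0; rewrite -EFinD lee_fin => cab.
by rewrite -EFin_min /= ge_min cab.
Qed.

Lemma support_size_interval_gt0 s : 0 < s -> 0 < support_size (initial_interval s).
Proof.
move=> s0; rewrite /support_size (_ : [set t | _] = [set` `[0, s[]).
  rewrite lebesgue_measure_itv /= lte_fin s0 oppr0 adde0.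
  by rewrite -EFin_min /= lt_min s0 ltr01.
apply/seteqP; split => t; rewrite /= in_itv /initial_interval /=.
  by case: (_ && _); rewrite ?eqxx.
by move=> ->.
Qed.

Lemma initial_interval_le0 s : s <= 0 -> initial_interval s = 0.
Proof.
move=> s0; apply/funext => t; rewrite /initial_interval.
have [t0|//] := leP 0 t; rewrite ltNge (le_trans s0 t0)//.
Qed.

(** The two intervals differ only between [s] and [t]. Hence [u |-> initial_interval (f u)] inherits
    continuity from [f]. *)
Lemma support_size_intervalB s t :
  support_size (initial_interval s - initial_interval t) <= `|s - t|.
Proof.
have H : (mu [set r | ((initial_interval s - initial_interval t) r != 0)%R] <=
    (`|s - t|)%:E)%E.
  apply: (@le_trans _ _ (mu ([set` `[Order.min s t, Order.max s t[] : set K))).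
    apply: le_mu => r /=; rewrite opprfctE addrfctE /initial_interval in_itv /=.
    case: (leP 0 r) => /= r0; last by [].
    have [rs|rs] := ltP r s; have [rt|rt] := ltP r t; rewrite ?subrr ?eqxx//= => _.
      by rewrite ge_min rt orbT lt_max rs.
    by rewrite ge_min rs lt_max rt orbT.
  rewrite lebesgue_measure_itv /=; case: ifPn => _; last by rewrite lee_fin.
  rewrite -EFinB lee_fin; have [st|st] := leP s t.
    by rewrite distrC ler_norm.
  by rewrite ler_norm.
move: (mu0 [set r | (initial_interval s - initial_interval t) r != 0]) H.
rewrite /support_size; case: (mu _) => [c||]//= c0; rewrite lee_fin => cst.
by rewrite -EFin_min /= ge_min cst.
Qed.

End IntervalGroup.

(** * Two non-P-points contradict the F'-property *)

Lemma continuous_pos_diff (K : realType) (T : topologicalType) (f g : T -> K) :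
  continuous f -> continuous g -> continuous (fun x => Num.max 0 (f x - g x)).
Proof.
move=> fc gc x; apply: (@continuous_max K T (cst 0) (fun x => f x - g x)).
  exact: cvg_cst.
by apply: cvgB; [exact: fc | exact: gc].
Qed.

(** The factor [max 0 (1/3 - a)] is positive near [x], so the product is still not locally zero
    there. As 1/3 is below 1/2, [a] and [1 - a] are never both under the threshold; cutting by one
    and by the other gives functions with product zero. *)
Lemma cutoff_function (K : realType) (X : topologicalType) (a f : X -> K) (x : X) :
  continuous a -> continuous f -> (forall u, 0 <= f u) -> f x = 0 -> a x = 0 ->
  ~ nbhs x [set u | f u = 0] ->
  exists g : X -> K, [/\ continuous g, forall u, 0 <= g u, g x = 0,
    ~ nbhs x [set u | g u = 0] & forall u, 3^-1 <= a u -> g u = 0].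
Proof.
move=> ac fc f0 fx ax nf.
pose c u := Num.max 0 (3^-1 - a u).
have cc : continuous c.
  by apply: continuous_pos_diff => // u; exact: cvg_cst.
exists (fun u => c u * f u); split.
- by move=> u; apply: cvgM; [exact: cc | exact: fc].
- by move=> u; rewrite mulr_ge0// le_max lexx.
- by rewrite fx mulr0.
- move=> ng; apply: nf.
  have cx : \forall u \near x, 0 < c u.
    apply: (cvgr_gt _ (cc x)); rewrite /c ax subr0 lt_max ltxx/= invr_gt0.
    by rewrite ltr0n.
  apply: filterS2 ng cx => u /= /eqP; rewrite mulf_eq0 => /orP[/eqP->|/eqP//].
  by rewrite ltxx.
- by move=> u au; rewrite /c max_l ?mul0r// subr_le0.
Qed.

Lemma non_P_points_separation (X : topologicalType) (x y : X) :
  tychonoff_space X -> ~ P_point x -> ~ P_point y -> x <> y ->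
  exists f g : X -> R, [/\ [/\ continuous f, forall u, 0 <= f u, f x = 0, f y = 0 &
      ~ nbhs x [set u | f u = 0]],
    [/\ continuous g, forall u, 0 <= g u, g x = 0, g y = 0 &
      ~ nbhs y [set u | g u = 0]] &
    forall u, f u = 0 \/ g u = 0].
Proof.
move=> tX nPx nPy xy.
have [f [fc f0 fx nf]] := non_P_point_function tX nPx.
have [g [gc g0 gy ng]] := non_P_point_function tX nPy.
have [a [ac [ax ay]]] : exists a : X -> R, continuous a /\ a x = 0 /\ a y = 1.
  have [] := tX.2 [set y] x => //; first exact: accessible_closed_set1 tX.1 _.
  by move=> a [ac [ax ay]]; exists a; split=> //; split=> //; exact: ay.
have a'c : continuous (fun u => 1 - a u).
  by move=> u; apply: (@cvgB _ R^o); [exact: cvg_cst | exact: ac].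
have a'y : 1 - a y = 0 by rewrite ay subrr.
have [f' [f'c f'0 f'x nf' f'a]] := cutoff_function ac fc f0 fx ax nf.
have [g' [g'c g'0 g'y ng' g'a]] := cutoff_function a'c gc g0 gy a'y ng.
exists f', g'; split.
- by split=> //; apply: f'a; rewrite ay; lra.
- by split=> //; apply: g'a; rewrite ax; lra.
- move=> u; have [/f'a|au] := leP 3^-1 (a u); first by left.
  by right; apply: g'a; move: au; lra.
Qed.

Lemma free_function_extension (K : realType) (X : topologicalType) (x0 : X)
    (B : topologicalZmodType) (e : X -> B) (f : X -> K) :
  free_boolean_group x0 e -> continuous f ->
  exists M : B -> K, [/\ continuous M,
    forall u w, f u = 0 -> f w = 0 -> M (e u + e w) = 0 &
    forall u w, 0 < f u -> f w = 0 -> 0 < M (e u + e w)].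
Proof.
move=> freeB fc.
have V2 := @boolean_group_F2fun K.
(* The shift sends [x0] to 0, as the universal property demands; in a sum of two generators it
   occurs twice and cancels. *)
pose g u := initial_interval (f u) - initial_interval (f x0).
have gx0 : g x0 = 0 by rewrite /g subrr.
have [u eps eps0|phi [phiD phie phic]] :=
    free_seminorm_extension freeB (@group_seminorm_support_size K) V2 gx0.
  have /cvgrPdist_lt /(_ _ eps0) := fc u.
  apply: filterS => v; rewrite distrC => uv; apply: le_lt_trans uv.
  rewrite /g opprB addrA subrK; exact: support_size_intervalB.
have phi2 u w : f w = 0 -> phi (e u + e w) = initial_interval (f u).
  move=> fw; rewrite phiD !phie /g fw (initial_interval_le0 (lexx _)) sub0r.
  by rewrite addrAC -addrA -opprD V2 oppr0 addr0.
exists (@support_size K \o phi); split=> // u w fu fw.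
  rewrite /= phi2// fu initial_interval_le0//.
  by have [] := @group_seminorm_support_size K.
by rewrite /= phi2// support_size_interval_gt0.
Qed.

Lemma closure_cozero_pos_diff (X : topologicalType) (B : topologicalZmodType)
    (e : X -> B) (f g : X -> R) (M N : B -> R) (x y : X) :
  continuous e -> (forall u, 0 <= f u) -> f y = 0 -> g y = 0 ->
  ~ nbhs x [set u | f u = 0] -> (forall u, f u = 0 \/ g u = 0) ->
  (forall u w, 0 < f u -> f w = 0 -> 0 < M (e u + e w)) ->
  (forall u w, g u = 0 -> g w = 0 -> N (e u + e w) = 0) ->
  closure (cozero (fun b => Num.max 0 (M b - N b))) (e x + e y).
Proof.
move=> ec f0 fy gy nf fg Mpos N0 W nW.
have tc : (fun u => e u + e y) @ x --> e x + e y.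
  apply: (@continuous_comp X (B * B)%type B (fun u => (e u, e y))
    (fun p => p.1 + p.2)); last exact: (@add_continuous B).
  by apply: (@cvg_pair _ _ _ _ (nbhs (e x)) (nbhs (e y)));
    [exact: (ec x) | exact: cvg_cst].
(* If a neighborhood [W] of [e x + e y] missed the cozero set, [f] would vanish at every [u] with
   [e u + e y] in [W], that is, near [x]. *)
apply: contrapT => /set0P/negP; rewrite negbK => /eqP/seteqP[WF _].
have nxW : nbhs x [set u | W (e u + e y)] := tc _ nW.
apply: nf; apply: filterS nxW => u Wu /=.
apply: contrapT => /eqP fu.
have fu0 : 0 < f u by rewrite lt_def fu f0.
have gu : g u = 0 by case: (fg u) => // fu'; rewrite fu' eqxx in fu.
apply: (WF (e u + e y)); split=> //.
rewrite /cozero /= N0// subr0 max_r; last exact/ltW/Mpos.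
by rewrite gt_eqF// Mpos.
Qed.

Lemma F'_at_most_one_non_P_point (X : topologicalType) (x0 : X)
    (B : topologicalZmodType) (e : X -> B) (x y : X) :
  tychonoff_space X -> free_boolean_group x0 e -> F'_space B ->
  ~ P_point x -> ~ P_point y -> x = y.
Proof.
move=> tX freeB FB nPx nPy; apply: contrapT => xy.
have [f [g [[fc f0 fx fy nf] [gc g0 gx gy ng] fg]]] :=
  non_P_points_separation tX nPx nPy xy.
have [M [Mc M0 Mpos]] := free_function_extension freeB fc.
have [N [Nc N0 Npos]] := free_function_extension freeB gc.
have [_ _ [_ [ec _]] _ _] := freeB.
have gf u : g u = 0 \/ f u = 0 by case: (fg u); [right | left].
have FG0 : cozero (fun b => Num.max 0 (M b - N b)) `&`
    cozero (fun b => Num.max 0 (N b - M b)) = set0.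
  apply/seteqP; split=> // b [] /=; rewrite /cozero /=.
  have [MN|NM] := leP (M b) (N b).
    by rewrite max_l ?eqxx// subr_le0.
  by rewrite [X in _ -> X != 0 -> _]max_l ?eqxx// subr_le0 ltW.
have := FB _ _ (continuous_pos_diff Mc Nc) (continuous_pos_diff Nc Mc) FG0.
move=> /seteqP[H _]; apply: (H (e x + e y)); split.
  exact: closure_cozero_pos_diff fg Mpos N0.
by rewrite addrC; exact: closure_cozero_pos_diff gf Npos M0.
Qed.

(** * Open sets in countable topological groups *)

(** A copy of [G] with the same topology, made a uniform space by translations in order to use the
    complete regularity of uniform spaces. *)
Definition translation_uniformity (G : topologicalZmodType) : Type := G.

Section TranslationUniformity.
Variable G : topologicalZmodType.
Local Notation U := (translation_uniformity G).
Local Open Scope relation_scope.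

HB.instance Definition _ := Topological.copy U G.

Definition translation_ent : set_system (U * U) :=
  filter_from (nbhs (0 : G)) (fun A => [set xy : G * G | A (xy.2 - xy.1)]).

Let ent_filter : Filter translation_ent.
Proof.
apply: filter_from_filter; first by exists setT; exact: filterT.
by move=> A B nA nB; exists (A `&` B) => //; exact: filterI.
Qed.

Let ent_diagonal (E : set (U * U)) : translation_ent E -> diagonal `<=` E.
Proof.
move=> [A nA AE] [x y] /diagonalP <-; apply: AE => /=.
by rewrite subrr; exact: nbhs_singleton.
Qed.

Let ent_inv (E : set (U * U)) : translation_ent E -> translation_ent E^-1.
Proof.
move=> [A nA AE]; exists (-%R @^-1` A).
  by apply: (@opp_continuous G 0); rewrite oppr0.
by move=> [x y] /= Axy; apply: AE; rewrite /= -opprB.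
Qed.

Let ent_split (E : set (U * U)) : translation_ent E ->
  exists2 F, translation_ent F & F \; F `<=` E.
Proof.
move=> [A nA AE].
have := @add_continuous G (0, 0) A; rewrite /= addr0 => /(_ nA).
move=> [[P Q] /= [nP nQ] PQA].
exists [set xy : G * G | (P `&` Q) (xy.2 - xy.1)].
  by exists (P `&` Q) => //; exact: filterI.
move=> [x y] [z /= [_ Qzx] [Pyz _]]; apply: AE => /=.
by have := PQA (y - z, z - x) (conj Pyz Qzx); rewrite /= addrA subrK.
Qed.

Let ent_nbhs : nbhs = nbhs_ translation_ent.
Proof.
apply/funext => x; apply/seteqP; split => A.
  move=> nA; exists [set xy : G * G | A (x + (xy.2 - xy.1))].
    exists [set u : G | A (x + u)] => //.
    have addx : (fun u : G => x + u) @ (0 : G) --> (x + 0 : G).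
      apply: (@continuous_comp G (G * G)%type G (fun u => (x : G, u))
        (fun p => p.1 + p.2)); last exact: (@add_continuous G).
      apply: (@cvg_pair _ _ _ _ (nbhs (x : G)) (nbhs (0 : G))).
        exact: cvg_cst.
      exact: cvg_id.
    by apply: addx; rewrite addr0.
  by move=> y /xsectionP /=; rewrite addrC subrK.
move=> [E [B nB BE] EA].
have subx : (fun u : G => u - (x : G)) @ (x : G) --> (x - x : G).
  apply: (@continuous_comp G (G * G)%type G (fun u => (u, x : G))
    (fun p => p.1 - p.2)); last exact: (@sub_continuous G).
  apply: (@cvg_pair _ _ _ _ (nbhs (x : G)) (nbhs (x : G))).
    exact: cvg_id.
  exact: cvg_cst.
rewrite subrr in subx; have nxB : nbhs x [set u : G | B (u - x)] := subx _ nB.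
by apply: filterS nxB => y /= Byx; apply: EA; apply/xsectionP; exact: BE.
Qed.

HB.instance Definition _ := Nbhs_isUniform_mixin.Build U
  ent_filter ent_diagonal ent_inv ent_split ent_nbhs.

Lemma topological_group_separation (K : realType) (A : set G) (a : G) :
  open A -> A a -> exists f : G -> K,
    [/\ continuous f, f a <> 0 & forall b, ~ A b -> f b = 0].
Proof.
move=> oA Aa; have sep : @uniform_separator G [set a] (~` A).
  apply: (@uniform_completely_regular K U a (~` A)); last by apply.
  exact: open_closedC.
have [f [fc _ f0 f1]] := (@uniform_separatorP G K _ _).1 sep.
have fa : f a = 0 by apply: f0; exists a.
exists (fun x => 1 - f x); split.
- by move=> x; apply: cvgB; [exact: cvg_cst | exact: fc].
- by rewrite fa subr0; exact/eqP/oner_neq0.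
- by move=> b nAb; rewrite (_ : f b = 1) ?subrr//; apply: f1; exists b.
Qed.

End TranslationUniformity.

(** Each point of [A] has a function that is nonzero there and vanishes off [A]. The common zero set
    of these countably many functions is the complement of [A]. *)
Lemma countable_group_open_cozero (G : topologicalZmodType) (A : set G) :
  countable [set: G] -> open A -> exists2 f : G -> R, continuous f & A = cozero f.
Proof.
move=> /countable_injP[i] iinj oA.
have /choice[f fP] n : exists f : G -> R, [/\ continuous f,
    forall b, ~ A b -> f b = 0 & forall a, A a -> i a = n -> f a <> 0].
  have [[a [Aa ian]]|na] := pselect (exists a, A a /\ i a = n).
    have [f [fc fa fA]] := topological_group_separation R oA Aa.
    exists f; split=> // b Ab ibn; rewrite (_ : b = a)//.
    by apply: (iinj b a); rewrite ?inE// ian.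
  (* An index that codes no point of [A] gets the zero function, which does not affect the common
     zero set. *)
  exists (fun=> 0); split=> //; first by move=> x; exact: cvg_cst.
  by move=> a Aa ian; case: na; exists a.
have fc n : continuous (f n) by have [] := fP n.
have [g [gc g0 gE]] := zero_set_bigcap fc.
exists g => //; apply/seteqP; split=> a.
  move=> Aa; apply/eqP => /gE /(_ (i a)).
  by have [_ _ /(_ a Aa erefl)] := fP (i a).
move=> /eqP ga; apply: contrapT => nAa; apply: ga; apply/gE => n.
by have [_ + _] := fP n; apply.
Qed.

(** [A] and the complement of its closure are disjoint cozero sets. Since their closures are
    disjoint, [closure A] is the complement of a closed set. *)
Lemma countable_F'_group_extremally_disconnected (G : topologicalZmodType) :
  countable [set: G] -> F'_space G -> extremally_disconnected G.
Proof.
move=> cG FG A oA.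
have oV : open (~` closure A) by apply: closed_openC; exact: closed_closure.
have [f fc fE] := countable_group_open_cozero cG oA.
have [g gc gE] := countable_group_open_cozero cG oV.
have fg0 : cozero f `&` cozero g = set0.
  rewrite -fE -gE; apply/seteqP; split=> // x [Ax]; apply.
  exact: subset_closure.
have := FG f g fc gc fg0; rewrite -fE -gE => AV.
suff -> : closure A = ~` closure (~` closure A).
  by apply: closed_openC; exact: closed_closure.
apply/seteqP; split=> x.
  by move=> Ax Vx; have : set0 x by rewrite -AV.
by move=> nVx; apply: contrapT => nAx; apply: nVx; exact: subset_closure.
Qed.

(** * Quotient topologies and quotient groups *)

Definition final_topology (X T : Type) (p : X -> T) : Type := T.

Section FinalTopology.
Variables (X : topologicalType) (T : choiceType) (p : X -> T).
Local Notation Z := (final_topology p).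

Definition final_open (A : set T) := open (p @^-1` A).

HB.instance Definition _ := Choice.on Z.

Let final_openT : final_open setT.
Proof. by rewrite /final_open preimage_setT; exact: openT. Qed.

Let final_openI : setI_closed final_open.
Proof. by move=> A B; exact: openI. Qed.

Let final_open_bigU (I : Type) (f : I -> set T) :
  (forall i, final_open (f i)) -> final_open (\bigcup_i f i).
Proof. by move=> fo; apply: bigcup_open => i _; exact: fo. Qed.

HB.instance Definition _ :=
  isOpenTopological.Build Z final_openT final_openI final_open_bigU.

Lemma final_openE (A : set Z) : open A = open (p @^-1` A).
Proof. by []. Qed.

Lemma final_topology_continuous : continuous (p : X -> Z).
Proof. exact/continuousP. Qed.

Lemma final_topology_comp (Y : topologicalType) (g : Z -> Y) :
  continuous g <-> continuous (g \o p).
Proof.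
split=> /continuousP gc; apply/continuousP => A oA; last exact: gc.
by rewrite comp_preimage; move/continuousP: final_topology_continuous; apply;
  exact: gc.
Qed.

End FinalTopology.

(** The quotient by the kernel of [q] is realized on [V] itself rather than on cosets. The proofs
    [qD] and [qS] are parameters because the group topology depends on them. *)
Definition quotient_group (G : topologicalZmodType) (V : zmodType) (q : G -> V)
  (qD : {morph q : u v / u + v}) (qS : forall y, exists x, q x = y) : Type :=
  final_topology q.

Section QuotientGroup.
Variables (G : topologicalZmodType) (V : zmodType) (q : G -> V).
Hypothesis qD : {morph q : u v / u + v}.
Hypothesis qS : forall y, exists x, q x = y.
Local Notation Q := (quotient_group qD qS).

HB.instance Definition _ := Topological.copy Q (final_topology q).
HB.instance Definition _ := GRing.Zmodule.copy Q V.

Let qN x : q (- x) = - q x.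
Proof. by apply: (addrI (q x)); rewrite -qD !subrr (morph_add0 qD). Qed.

(** The map [q] is open: the saturation of an open set is the union of its translates by the
    kernel. *)
Lemma quotient_group_nbhs (x : G) (A : set G) :
  nbhs x A -> nbhs (q x : Q) (q @` A).
Proof.
rewrite nbhsE => -[W [oW Wx] WA].
apply: (@filterS _ _ _ (q @` W)); first exact: image_subset.
apply: open_nbhs_nbhs; split; last by exists x.
change (open (q @^-1` (q @` W))).
rewrite (_ : _ @^-1` _ = \bigcup_(k in [set k | q k = 0]) [set y | W (y - k)]).
  apply: bigcup_open => k _.
  have subk : continuous (fun y : G => y - k).
    move=> y; apply: (@continuous_comp G (G * G)%type G (fun u => (u, k))
      (fun p => p.1 - p.2)); last exact: (@sub_continuous G).
    apply: (@cvg_pair _ _ _ _ (nbhs y) (nbhs k)); first exact: cvg_id.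
    exact: cvg_cst.
  by move/continuousP: subk; apply.
apply/seteqP; split=> y.
  move=> [z Wz zy]; exists (y - z); first by rewrite /= qD qN zy subrr.
  by rewrite /= opprB addrC subrK.
move=> [k /= qk Wyk]; exists (y - k) => //.
by rewrite qD qN qk subr0.
Qed.

Let sub_continuous : continuous (fun x : Q * Q => x.1 - x.2).
Proof.
move=> [a b] A /= nA.
have [a' qa] := qS a; have [b' qb] := qS b.
have nA' : nbhs (a' - b') (q @^-1` A).
  apply: (@final_topology_continuous G V q (a' - b')).
  by rewrite qD qN qa qb.
have [[P S] /= [nP nS] PS] := @sub_continuous G (a', b') _ nA'.
exists (q @` P, q @` S).
  by split; rewrite /= -?qa -?qb; exact: quotient_group_nbhs.
move=> [x y] /= [[x' Px <-] [y' Sy <-]].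
by have := PS (x', y') (conj Px Sy); rewrite /= qD qN.
Qed.

HB.instance Definition _ :=
  PreTopologicalNmodule_isTopologicalZmodule.Build Q sub_continuous.

(** As [q] is open, a point lying over the closure of [cozero h] is in the closure of
    [cozero (h \o q)], so the property can be tested in [G]. *)
Lemma quotient_group_F'_space : F'_space G -> F'_space Q.
Proof.
move=> FG f g fc gc fg0.
have fqc : continuous (f \o q) by exact: (@final_topology_comp G V q _ f).1.
have gqc : continuous (g \o q) by exact: (@final_topology_comp G V q _ g).1.
have cl (h : Q -> R) b : closure (cozero h) (q b) -> closure (cozero (h \o q)) b.
  move=> hb W nW; have [z [hz [x Wx qx]]] := hb _ (quotient_group_nbhs nW).
  by exists x; split=> //; rewrite /cozero /= qx.
apply/seteqP; split=> // y [fy gy]; have [b qb] := qS y.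
rewrite -qb in fy gy.
have fgq0 : cozero (f \o q) `&` cozero (g \o q) = set0.
  apply/seteqP; split=> // x [fx gx].
  have : (cozero f `&` cozero g) (q x) by split.
  by rewrite fg0.
have : (closure (cozero (f \o q)) `&` closure (cozero (g \o q))) b.
  by split; exact: cl.
by rewrite FG.
Qed.

End QuotientGroup.

(** * A countable quotient space with one nonisolated point *)

(** The fibre of [f] through [y] is a [G_delta] set, cut out by the conditions
    [|f y - f u| < 1/(n+1)]. *)
Lemma P_point_locally_constant (K : realType) (X : topologicalType) (f : X -> K)
    (y : X) :
  continuous f -> P_point y -> nbhs y [set u | f u = f y].
Proof.
move=> fc /(_ (fun n => f @^-1` [set t | `|f y - t| < n.+1%:R^-1])) Py.
have /Py : forall n, open (f @^-1` [set t : K | `|f y - t| < n.+1%:R^-1]).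
  move=> n; apply: (proj1 (continuousP f) fc).
  exact: (@ball_open K K^o (f y) n.+1%:R^-1).
have H n : (f @^-1` [set t : K | `|f y - t| < n.+1%:R^-1]) y.
  by rewrite /= subrr normr0 invr_gt0 ltr0n.
move=> /(_ H); apply: filterS => u uy /=.
apply: contrapT => /eqP; rewrite eq_sym -subr_eq0 -normr_gt0 => fyu.
have [N _ /(_ N (leqnn N)) /=] := near_infty_natSinv_lt (PosNum fyu).
by rewrite ltNge (ltW (uy N I)).
Qed.

(** The sets [E n] are clopen, increase, and exhaust the cozero set of [f]. Along a subsequence [D]
    that grows strictly, [p u] is the first [k] with [u] in [D k], and [None] if there is none. *)
Lemma P_point_fibration (K : realType) (X : topologicalType) (x : X) (f : X -> K) :
  (forall y, y <> x -> P_point y) -> continuous f -> (forall u, 0 <= f u) ->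
  f x = 0 -> ~ nbhs x [set u | f u = 0] ->
  exists p : X -> option nat, [/\ forall z, exists u, p u = z,
    forall k, clopen (p @^-1` [set Some k]) & ~ open (p @^-1` [set None])].
Proof.
move=> Px fc f0 fx nf.
pose E n := [set u | n.+1%:R^-1 <= f u].
have Ec n : closed (E n).
  by apply: preimage_closed (@closed_ge K n.+1%:R^-1) => u _; exact: fc.
have Eo n : open (E n).
  rewrite openE => y Ey; have yx : y <> x.
    move=> yx; move: Ey; rewrite /E /= yx fx leNgt invr_gt0.
    by rewrite ltr0n.
  apply: filterS (P_point_locally_constant fc (Px y yx)) => u /= fuy.
  by rewrite /E /= fuy.
have Emon n m : (n <= m)%N -> E n `<=` E m.
  move=> nm u; apply: le_trans.
  by rewrite lef_pV2 ?posrE ?ltr0n// ler_nat.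
have Efull u : f u <> 0 -> exists n, E n u.
  move=> /eqP fu; have fu0 : 0 < f u by rewrite lt_def fu f0.
  have [N _ /(_ N (leqnn N)) /= NE] := near_infty_natSinv_lt (PosNum fu0).
  by exists N; exact: ltW.
have Epos n u : E n u -> f u <> 0.
  move=> /[swap] fu; rewrite /E /= fu leNgt invr_gt0.
  by rewrite ltr0n.
(* If no later set exceeded [E n], then [f] would vanish on the complement of [E n], a neighborhood
   of [x]. *)
have /choice[g gP] n : exists m, (n < m)%N /\ exists u, E m u /\ ~ E n u.
  apply: contrapT => H; apply: nf.
  have : nbhs x (~` E n).
    by apply: open_nbhs_nbhs; split; [exact: closed_openC | move=> /Epos; apply].
  apply: filterS => u nEu /=; apply: contrapT => /Efull[m Emu]; apply: H.
  exists (maxn n.+1 m); split; first exact: leq_maxl.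
  by exists u; split=> //; exact: Emon (leq_maxr _ _) _ Emu.
(* Starting at [g 0] and not at 0 makes the first fibre nonempty, since [E (g 0)] has a point
   outside [E 0]. *)
pose c k := iter k g (g 0%N).
have c_ge k : (k <= c k)%N.
  by elim: k => [//|k IH]; apply: leq_ltn_trans IH _; case: (gP (c k)).
have cmon j k : (j <= k)%N -> (c j <= c k)%N.
  elim: k => [|k IH]; first by rewrite leqn0 => /eqP ->.
  rewrite leq_eqVlt => /predU1P[->//|]; rewrite ltnS => /IH.
  by move=> /leq_trans; apply; apply: ltnW; case: (gP (c k)).
pose D k := E (c k).
have Dmon j k : (j <= k)%N -> D j `<=` D k by move=> /cmon; exact: Emon.
have /choice[p pP] u : exists z : option nat,
    if z is Some k then D k u /\ forall j, D j u -> (k <= j)%N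
    else forall k, ~ D k u.
  have [Du|nD] := pselect (exists k, `[< D k u >]).
    have [k /asboolP Dk kmin] := ex_minnP Du; exists (Some k).
    by split=> // j /asboolP; exact: kmin.
  by exists None => k Dk; apply: nD; exists k; exact/asboolP.
have pE u k : D k u -> (forall j, D j u -> (k <= j)%N) -> p u = Some k.
  move=> Dk kmin; have := pP u; case: (p u) => [j [Dj jmin]|/(_ k)//].
  by congr Some; apply/eqP; rewrite eqn_leq kmin// jmin.
have fib0 : p @^-1` [set Some 0%N] = D 0%N.
  apply/seteqP; split=> u /=; first by have := pP u => /[swap] -> [].
  by move=> D0; exact: pE.
have fibS k : p @^-1` [set Some k.+1] = D k.+1 `\` D k.
  apply/seteqP; split=> u /=.
    have := pP u => /[swap] -> [Dk kmin]; split=> // /kmin.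
    by rewrite ltnn.
  move=> [Dk nDk]; apply: pE => // j Dj; rewrite ltnNge; apply/negP => jk.
  by apply: nDk; exact: Dmon Dj.
have pxN : p x = None by have := pP x; case: (p x) => // k [/Epos /(_ fx)].
exists p; split.
- case=> [[|k]|].
  + have [_ [u [Eu _]]] := gP 0%N; exists u.
    by have : (p @^-1` [set Some 0%N]) u by rewrite fib0.
  + have [_ [u [Eu nEu]]] := gP (c k); exists u.
    by have : (p @^-1` [set Some k.+1]) u by rewrite fibS.
  + by exists x.
- case=> [|k]; first by rewrite fib0; split; [exact: Eo | exact: Ec].
  rewrite fibS; split.
    by apply: openI; [exact: Eo | exact/closed_openC/Ec].
  by apply: closedI; [exact: Ec | exact/open_closedC/Eo].
- move=> op; apply: nf.
  have : nbhs x (p @^-1` [set None]) by exact: open_nbhs_nbhs.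
  apply: filterS => u /= pu; apply: contrapT => /Efull[n En].
  by have := pP u; rewrite pu => /(_ n); apply; exact: Emon (c_ge n) _ En.
Qed.

Lemma locally_constant_continuous (X Y : topologicalType) (f : X -> Y) :
  (forall x, nbhs x [set u | f u = f x]) -> continuous f.
Proof.
move=> fl x A nA; apply: filterS (fl x) => u /= fu.
by rewrite fu; exact: nbhs_singleton.
Qed.

Section CountableImage.
Variables (X : topologicalType) (p : X -> option nat).
Hypothesis pS : forall z, exists u, p u = z.
Hypothesis pC : forall k, clopen (p @^-1` [set Some k]).
Local Notation Z := (final_topology p).

Lemma final_open_Some (A : set Z) : ~ A None -> open A.
Proof.
move=> nA; rewrite final_openE.
rewrite (_ : _ @^-1` _ = \bigcup_(k in [set k | A (Some k)]) p @^-1` [set Some k]).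
  by apply: bigcup_open => k _; exact: (pC k).1.
apply/seteqP; split=> u /=; last by move=> [k /= Ak ->].
by case pu: (p u) => [k|] Au //; exists k.
Qed.

Lemma final_closed_Some (k : nat) : closed [set Some k : Z].
Proof. by rewrite -openC final_openE; apply: closed_openC; exact: (pC k).2. Qed.

(** A point off a closed set [A] has a clopen neighborhood missing [A]: the singleton of [Some k],
    or, for [None], the complement of [A]. Its indicator separates. *)
Lemma final_tychonoff : tychonoff_space Z.
Proof.
split.
  move=> a b ab; exists (~` [set b]).
  split; [|by apply/mem_set/eqP|by apply/mem_set; apply].
  case: b ab => [k|] _; first by apply: closed_openC; exact: final_closed_Some.
  by apply: final_open_Some => /=; apply.
move=> A a cA nAa.
have [U [cU oU Ua UA]] : exists U : set Z,
    [/\ closed U, open U, U a & forall b, A b -> ~ U b].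
  case: a nAa => [k|] nAa.
    exists [set Some k]; split=> //; first exact: final_closed_Some.
      exact: final_open_Some.
    by move=> b Ab bk; apply: nAa; rewrite -bk.
  exists (~` A); split=> //; first by apply: open_closedC; exact: final_open_Some.
    exact: closed_openC.
  by move=> b Ab; apply.
exists (fun z => if `[< U z >] then 0 else 1); split; last first.
  split=> [|b /UA nUb]; first by rewrite asboolT.
  by rewrite asboolF.
apply: locally_constant_continuous => z.
have [Uz|nUz] := asboolP (U z).
  have : nbhs z U by exact: open_nbhs_nbhs.
  by apply: filterS => w Uw /=; rewrite asboolT.
have : nbhs z (~` U) by apply: open_nbhs_nbhs; split=> //; exact: closed_openC.
by apply: filterS => w nUw /=; rewrite asboolF.
Qed.

Lemma final_R_quotient : R_quotient (p : X -> Z).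
Proof.
split; first exact: final_topology_continuous.
by split=> // phi; exact: final_topology_comp.
Qed.

Lemma final_one_nonisolated_point : ~ open (p @^-1` [set None]) ->
  exists z : Z, ~ isolated_point z /\ forall z', z' <> z -> isolated_point z'.
Proof.
move=> np; exists None; split=> // z zN.
by apply: final_open_Some => /= Nz; exact: zN.
Qed.

End CountableImage.

(** * The algebraic free Boolean group on a countable set *)

Lemma morph_addN (U V : zmodType) (phi : U -> V) :
  {morph phi : u v / u + v} -> {morph phi : u / - u}.
Proof.
by move=> phiD u; apply: (addrI (phi u)); rewrite -phiD !subrr (morph_add0 phiD).
Qed.

Lemma F2_cases (a : 'F_2) : a = 0 \/ a = 1.
Proof. by case: a => [[|[|//]] H]; [left | right]; apply/val_inj. Qed.

Local Notation P := {poly 'F_2}.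

Lemma boolean_group_polyF2 : boolean_group P.
Proof.
move=> v; apply/polyP => i; rewrite coefD coef0.
by have [->|->] := F2_cases v`_i; apply/val_inj.
Qed.

Lemma polyF2_ind (S : set P) : S 0 -> (forall u v, S u -> S v -> S (u + v)) ->
  (forall k, S 'X^k) -> forall v, S v.
Proof.
move=> S0 SD SX v; rewrite -[v]coefK poly_def.
apply: (big_ind S) => // i _.
by have [->|->] := F2_cases v`_i; rewrite ?scale0r// scale1r.
Qed.

(* [{poly 'F_2}] is the group of finite subsets of [nat], ['X^k] being [{k}];
   [None], the nonisolated point of [Z], is the base point. *)
Definition poly_point (z : option nat) : P := if z is Some k then 'X^k else 0.

Lemma poly_point_inj : injective poly_point.
Proof.
have X0 k : 'X^k <> 0 :> P.
  by move=> /(congr1 (fun v : P => v`_k)); rewrite coefXn eqxx coef0.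
move=> [j|] [k|] //= => [jk|/X0//|/esym/X0//].
have := congr1 (fun v : P => v`_j) jk; rewrite !coefXn eqxx.
by case: eqP => [->|].
Qed.

Section Extension.
Variables (H : zmodType) (H2 : boolean_group H) (f : option nat -> H).
Hypothesis f0 : f None = 0.

(** The case distinction plays the part of scalar multiplication by ['F_2], [H] being only an
    abelian group. *)
Let term (v : P) (i : nat) : H := if v`_i == 0 then 0 else f (Some i).

Definition poly_extension (v : P) : H := \sum_(i < size v) term v i.

Let extensionE (v : P) n : (size v <= n)%N ->
  poly_extension v = \sum_(i < n) term v i.
Proof.
move=> vn; rewrite /poly_extension (big_ord_widen n (term v) vn) big_mkcond.
apply: eq_bigr => i _; case: ltnP => // vi.
by rewrite /term (nth_default _ vi) eqxx.
Qed.

(** Here [H2] enters: [1 + 1 = 0] for coefficients must match [h + h = 0] in [H]. *)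
Let termD (u v : P) i : term (u + v) i = term u i + term v i.
Proof.
rewrite /term coefD.
have F11 : 1 + 1 = 0 :> 'F_2 by apply/val_inj.
by have [->|->] := F2_cases u`_i; have [->|->] := F2_cases v`_i;
  rewrite ?F11 ?addr0 ?add0r ?eqxx ?oner_eq0 ?addr0 ?add0r ?H2.
Qed.

Lemma poly_extensionD : {morph poly_extension : u v / u + v}.
Proof.
move=> u v; pose n := maxn (size u) (size v).
rewrite (@extensionE u n) ?leq_maxl// (@extensionE v n) ?leq_maxr//.
rewrite (@extensionE _ n) ?size_polyD// -big_split.
by apply: eq_bigr => i _; rewrite termD.
Qed.

Lemma poly_extension_point z : poly_extension (poly_point z) = f z.
Proof.
case: z => [k|] /=; last by rewrite /poly_extension size_poly0 big_ord0 f0.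
rewrite /poly_extension size_polyXn big_ord_recr big1 /=.
  by rewrite add0r /term coefXn eqxx oner_eq0.
by move=> i _; rewrite /term coefXn (ltn_eqF (ltn_ord i)) eqxx.
Qed.

End Extension.

(** * The quotient of the free group is free over the countable space *)

Section FreeQuotient.
Variables (X : topologicalType) (x0 : X) (B : topologicalZmodType) (e : X -> B).
Hypothesis freeB : free_boolean_group x0 e.
Variable p : X -> option nat.
Hypothesis pS : forall z, exists u, p u = z.
Hypothesis pC : forall k, clopen (p @^-1` [set Some k]).
Variable q : B -> P.
Hypothesis qD : {morph q : u v / u + v}.
Hypothesis qe : forall u, q (e u) = poly_point (p u) - poly_point (p x0).
Local Notation Z := (final_topology p).

Lemma free_quotient_surj v : exists b, q b = v.
Proof.
apply: (@polyF2_ind [set v | exists b, q b = v]).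
- by exists 0; rewrite (morph_add0 qD).
- by move=> _ _ [b <-] [c <-]; exists (b + c); rewrite qD.
(* The base point [x0] may lie over any point of [Z]; a difference of two generators removes the
   resulting shift in [qe]. *)
- move=> k; have [u pu] := pS (Some k); have [w pw] := pS None.
  exists (e u - e w); rewrite qD (morph_addN qD) !qe pu pw /=.
  by rewrite sub0r opprK subrK.
Qed.

Local Notation Q := (quotient_group qD free_quotient_surj).

Let q_continuous : continuous (q : B -> Q).
Proof. exact: (@final_topology_continuous B P q). Qed.

Let quotient_comp (Y : topologicalType) (g : Q -> Y) :
  continuous (g \o q) -> continuous g.
Proof. by move=> gq; exact: (@final_topology_comp B P q Y g).2. Qed.

Let e_continuous : continuous e.
Proof. by have [_ _ [_ []]] := freeB. Qed.

Let e_gen b : exists s : seq X, b = \sum_(x <- s) e x.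
Proof. by have [_ _ _ + _] := freeB; apply. Qed.

(** Composed with [p], the map is [q \o e] followed by a translation. *)
Lemma poly_point_continuous : continuous (poly_point : Z -> Q).
Proof.
apply/(@final_topology_comp X _ p Q) => u.
pose a : Q := poly_point (p x0).
rewrite (_ : _ \o _ = fun w => (q (e w) : Q) + a).
  apply: (@continuous_comp X (Q * Q)%type Q (fun w => (q (e w) : Q, a))
    (fun r => r.1 + r.2)); last exact: (@add_continuous Q).
  apply: (@cvg_pair _ _ _ _ (nbhs (q (e u) : Q)) (nbhs a)).
    exact: (continuous_comp (e_continuous (x:=u)) (q_continuous (x:=e u))).
  exact: cvg_cst.
by apply/funext => w /=; rewrite qe subrK.
Qed.

(** A seminorm with values 0 and 1: the finite sets avoiding [S] form a subgroup, which is open in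
    [Q] once [meets S] is continuous. *)
Definition meets (S : set nat) (v : P) : R :=
  if `[< exists k, S k /\ v`_k != 0 >] then 1 else 0.

Lemma meets_continuous (S : set nat) :
  closed [set z : Z | if z is Some k then S k else False] ->
  continuous (meets S : Q -> R).
Proof.
move=> cS; apply: quotient_comp.
have hN : group_seminorm (meets S).
  split; first by rewrite /meets asboolF// => -[k []]; rewrite coef0 eqxx.
  move=> u v; rewrite /meets.
  have [uS|nu] := asboolP (exists k, S k /\ u`_k != 0).
    by do 2 case: asboolP => _; lra.
  have [vS|nv] := asboolP (exists k, S k /\ v`_k != 0).
    by case: asboolP => _; lra.
  rewrite asboolF ?addr0// => -[k [Sk]]; rewrite coefB.
  have [uk|uk] := eqVneq u`_k 0; last by case: nu; exists k.
  have [vk|vk] := eqVneq v`_k 0; last by case: nv; exists k.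
  by rewrite uk vk subr0 eqxx.
have fx0 : poly_point (p x0) - poly_point (p x0) = 0 by rewrite subrr.
have [|phi [phiD phie phic]] :=
    free_seminorm_extension (f := fun u => poly_point (p u) - poly_point (p x0))
      freeB hN boolean_group_polyF2 fx0.
  move=> u eps eps0.
  (* Near a point over [Some k] the map [p] is constant; near a point over [None] it avoids the
     closed set [S]. *)
  have const : nbhs u [set w | meets S (poly_point (p w) - poly_point (p u)) = 0].
    case pu: (p u) => [k|].
      have : nbhs u (p @^-1` [set Some k]).
        by apply: open_nbhs_nbhs; split=> //; exact: (pC k).1.
      by apply: filterS => w /= ->; rewrite subrr hN.1.
    have : nbhs u (p @^-1` ~` [set z : Z | if z is Some k then S k else False]).
      apply: open_nbhs_nbhs; split; last by rewrite /= pu.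
      exact: (closed_openC cS).
    apply: filterS => w /= nSw; rewrite subr0 /meets asboolF// => -[k [Sk]].
    case pw: (p w) nSw => [j|] /= nSj; last by rewrite coef0 eqxx.
    rewrite coefXn; have [kj _|_] := eqVneq k j; last by rewrite eqxx.
    by case: nSj; rewrite -kj.
  by apply: filterS const => w /=; rewrite opprB addrA subrK => ->.
(* The extension agrees with [q] on generators, so the continuity found for [phi] is that of
   [meets S \o q]. *)
have qphi : q =1 phi by apply: (eq_on_generators e_gen) => // u; rewrite phie.
by rewrite (_ : _ \o _ = meets S \o phi)//; apply/funext => b /=; rewrite qphi.
Qed.

Lemma poly_point_embedding : embedding (poly_point : Z -> Q).
Proof.
split; first exact: poly_point_inj.
split; first exact: poly_point_continuous.
move=> U oU.
have meets_point S z : meets S (poly_point z) =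
    if `[< if z is Some k then S k else False >] then 1 else 0.
  rewrite /meets; congr (if _ then _ else _); apply/asboolP/asboolP.
    move=> [k [Sk]]; case: z => [j|] /=; last by rewrite coef0 eqxx.
    by rewrite coefXn; have [<-|_] := eqVneq k j; rewrite ?eqxx.
  case: z => // k Sk; exists k; split=> //.
  by rewrite coefXn eqxx.
(* If [U] contains [None], it is the trace of the finite sets avoiding its closed complement;
   otherwise it is a union of singletons, each the trace of the finite sets containing [k]. *)
have [UN|nUN] := pselect (U None).
  pose S := [set k | ~ U (Some k)].
  have cS : closed [set z : Z | if z is Some k then S k else False].
    rewrite (_ : mkset _ = ~` U); first exact: open_closedC.
    by apply/seteqP; split=> -[k|].
  exists [set v : Q | meets S v < 1]; split.
    exact: (proj1 (continuousP _) (meets_continuous cS) _ (@open_lt R 1)).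
  apply/seteqP; split=> z /=; rewrite meets_point.
    case: asboolP; rewrite ?ltxx// => nS _; case: z nS => // k nS.
    exact: contrapT.
  move=> Uz; rewrite asboolF ?ltr01//.
  by case: z Uz => [k|] Uz // /(_ Uz).
have cS k : closed [set z : Z | if z is Some j then [set k] j else False].
  rewrite (_ : mkset _ = [set Some k]); first exact: final_closed_Some.
  by apply/seteqP; split=> -[j|] //= => [->|[->]].
exists (\bigcup_(k in [set k | U (Some k)]) [set v : Q | 0 < meets [set k] v]).
split.
  apply: bigcup_open => k _.
  exact: (proj1 (continuousP _) (meets_continuous (cS k)) _ (@open_gt R 0)).
apply/seteqP; split=> z.
  move=> [k /= Uk]; rewrite meets_point; case: asboolP; rewrite ?ltxx// => + _.
  by case: z => // j /= ->.
case: z => // k Uk; exists k => //.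
by have := meets_point [set k] (Some k); rewrite asboolT//= => ->; exact: ltr01.
Qed.

Lemma free_boolean_quotient : free_boolean_group (None : Z) (poly_point : Z -> Q).
Proof.
split=> //.
- exact: boolean_group_polyF2.
- exact: poly_point_embedding.
- apply: (@polyF2_ind [set v | exists s : seq Z, v = \sum_(x <- s) poly_point x]).
  + by exists [::]; rewrite big_nil.
  + by move=> _ _ [s ->] [t ->]; exists (s ++ t); rewrite big_cat.
  + by move=> k; exists [:: Some k]; rewrite big_seq1.
- move=> H f H2 fc f0.
  exists (poly_extension f); split.
  (* Continuity is tested on [B], where the map is the extension of [f \o p] shifted to vanish at
     [x0]. *)
  + apply: quotient_comp.
    have [_ _ _ _ univ] := freeB.
    have [||phi [phic phiD phie]] := univ H (fun u => f (p u) - f (p x0)) H2.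
    * move=> u.
      apply: (@continuous_comp X (H * H)%type H (fun w => (f (p w), f (p x0)))
        (fun r => r.1 - r.2)); last exact: (@sub_continuous H).
      apply: (@cvg_pair _ _ _ _ (nbhs (f (p u))) (nbhs (f (p x0)))).
        exact: (proj1 (final_topology_comp f) fc).
      exact: cvg_cst.
    * by rewrite subrr.
    suff -> : poly_extension f \o q = phi by [].
    apply/funext; apply: (eq_on_generators e_gen) => //=.
      by move=> u v /=; rewrite qD poly_extensionD.
    move=> u /=; have fD := poly_extensionD H2 f.
    by rewrite qe fD (morph_addN fD) !poly_extension_point// phie.
  + exact: poly_extensionD.
  + exact: poly_extension_point.
Qed.

End FreeQuotient.

Lemma F'_free_quotient (X : topologicalType) (x0 : X) (B : topologicalZmodType)
    (e : X -> B) (p : X -> option nat) :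
  free_boolean_group x0 e -> F'_space B ->
  (forall z, exists u, p u = z) -> (forall k, clopen (p @^-1` [set Some k])) ->
  exists (BZ : topologicalZmodType) (eZ : final_topology p -> BZ) (q : B -> BZ),
    [/\ free_boolean_group (None : final_topology p) eZ,
      extremally_disconnected BZ & topological_quotient_group q].
Proof.
move=> freeB FB pS pC; have [_ _ _ _ univ] := freeB.
pose f u := poly_point (p u) - poly_point (p x0).
(* Only the homomorphism [q] is wanted here. The zero seminorm gives the indiscrete topology, into
   which every map is continuous. *)
have hN : group_seminorm (fun _ : P => 0 : R) by split=> // *; rewrite addr0.
have fx0 : f x0 = 0 by rewrite /f subrr.
have [|q [qD qe _]] := free_seminorm_extension freeB hN boolean_group_polyF2 fx0.
  by move=> u eps eps0; exact: nearW.
pose qS := free_quotient_surj pS qD qe.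
exists (quotient_group qD qS), poly_point, q; split.
- exact: free_boolean_quotient.
- apply: countable_F'_group_extremally_disconnected.
    exact: (@countableP P).
  exact: quotient_group_F'_space.
- by split.
Qed.

Theorem theorem3 (X : topologicalType) (x0 : X) (B : topologicalZmodType) (e : X -> B) :
  tychonoff_space X -> free_boolean_group x0 e -> F'_space B ->
  (* (1) at most one non-P-point *)
  (forall x y : X, ~ P_point x -> ~ P_point y -> x = y) /\
  (* (2) *)
  (~ P_space X ->
   exists (Z : topologicalType) (p : X -> Z),
     [/\ countable [set: Z], tychonoff_space Z,
         (exists z : Z, ~ isolated_point z /\ forall z', z' <> z -> isolated_point z'),
         R_quotient p &
         exists (z0 : Z) (BZ : topologicalZmodType) (eZ : Z -> BZ) (q : B -> BZ),
           [/\ free_boolean_group z0 eZ, extremally_disconnected BZ &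
               topological_quotient_group q]]).
Proof.
move=> tX freeB FB.
have uniq (x y : X) : ~ P_point x -> ~ P_point y -> x = y.
  exact: F'_at_most_one_non_P_point tX freeB FB.
split=> // /existsNP[x nPx].
have Px y : y <> x -> P_point y.
  by move=> yx; apply: contrapT => nPy; exact/yx/uniq.
have [f [fc f0 fx nf]] := non_P_point_function tX nPx.
have [p [pS pC pN]] := P_point_fibration Px fc f0 fx nf.
exists (final_topology p), p; split.
- exact: (@countableP (option nat)).
- exact: final_tychonoff.
- exact: final_one_nonisolated_point.
- exact: final_R_quotient.
- by exists None; exact: F'_free_quotient freeB FB pS pC.
Qed.
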